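(* Let $T$ be a closed normal operator on a complex Hilbert space $H$, let $0\le p\le1$, $c\ge0$, and let $A$ be a linear operator on $H$ with $\mathcal D(T)\subseteq\mathcal D(A)$ and $$\|Ax\|\le c\,\|x\|^{1-p}\|Tx\|^p\qquad\text{for all }x\in\mathcal D(T).$$ Assume that there exist real $\alpha_T<\beta_T$ such that $\{z\in\mathbb C:\alpha_T<\operatorname{Re} z<\beta_T\}\subseteq\rho(T)$, and that $|\operatorname{Im} t|\le\gamma_T$ for all $t\in\sigma(T)$, for some $\gamma_T\ge0$. If $$2c\cdot\max\{|\alpha_T+\mathrm i\gamma_T|^p,\ |\beta_T+\mathrm i\gamma_T|^p\}<\beta_T-\alpha_T,$$ then $$\{z\in\mathbb C:\alpha'_{T,p}<\operatorname{Re} z<\beta'_{T,p}\}\subseteq\rho(T+A),$$ where $$\alpha'_{T,p}=\alpha_T+c\cdot\max\{|\alpha_T+\mathrm i\gamma_T|^p,|\beta_T+\mathrm i\gamma_T|^p\},\qquad \beta'_{T,p}=\beta_T-c\cdot\max\{|\alpha_T+\mathrm i\gamma_T|^p,|\beta_T+\mathrm i\gamma_T|^p\}.$$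
   Context: $\mathcal D(S)$ denotes the domain of an operator $S$. A closed densely defined operator $T$ on $H$ is normal if $TT^*=T^*T$. The operator $T+A$ has domain $\mathcal D(T)$. The resolvent set $\rho(S)$ is the set of $z\in\mathbb C$ such that $S-z:\mathcal D(S)\to H$ is bijective with bounded inverse; $\sigma(S)=\mathbb C\setminus\rho(S)$. The convention $0^0=1$ is used. *)

(* Defs.v *)
From HB Require Import structures.
From mathcomp Require Import all_boot all_order all_algebra sesquilinear.
From mathcomp Require Import all_classical all_reals all_analysis.
From mathcomp Require Import complex.

Set Implicit Arguments.
Unset Strict Implicit.
Unset Printing Implicit Defensive.

Import Order.TTheory GRing.Theory Num.Theory.
Import numFieldNormedType.Exports.
Local Open Scope classical_set_scope.
Local Open Scope complex_scope.
Local Open Scope ring_scope.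

(* A complex Hilbert space is a complete normed space over R[i] whose norm is
   induced by a positive definite Hermitian form (linear on the left,
   conjugate-linear on the right). *)
Definition induces_norm (R : realType) (H : completeNormedModType R[i])
    (dot : {dot H for @Num.conj R[i]}) : Prop :=
  forall x : H, `|x| ^+ 2 = dot x x.

(* The library's norm on H takes its values in R[i]. *)
Definition hnorm (R : realType) (H : normedModType R[i]) (x : H) : R :=
  complex.Re `|x|.

Definition cabs (R : realType) (z : R[i]) : R := complex.Re `|z|.

(* Partially defined maps on H; the values of [opfun] off [opdom] are
   irrelevant, so operators are compared with [op_eq]. *)
Record operator (H : Type) := Operator { opdom : set H; opfun :> H -> H }.

Section Operators.
Variables (R : realType) (H : completeNormedModType R[i]).
Variable dot : {dot H for @Num.conj R[i]}.
Implicit Types (S T A : operator H).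

Definition linear_operator S : Prop :=
  opdom S 0 /\
  forall (a : R[i]) (x y : H), opdom S x -> opdom S y ->
    opdom S (a *: x + y) /\ S (a *: x + y) = a *: S x + S y.

Definition op_eq S T : Prop :=
  opdom S = opdom T /\ forall x, opdom S x -> S x = T x.

Definition op_comp S T : operator H :=
  Operator [set x | opdom T x /\ opdom S (T x)] (fun x => S (T x)).

Definition op_add T A : operator H :=
  Operator (opdom T) (fun x => T x + A x).

Definition closed_operator S : Prop :=
  closed [set xy : H * H | opdom S xy.1 /\ xy.2 = S xy.1].

Definition densely_defined S : Prop := dense (opdom S).

Definition adjoint_value T (y z : H) : Prop :=
  forall x, opdom T x -> dot (T x) y = dot x z.

(* For densely defined T the vector z is unique, so [xget] returns it. *)
Definition adjoint T : operator H :=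
  Operator [set y | exists z, adjoint_value T y z]
           (fun y => xget 0 [set z | adjoint_value T y z]).

Definition normal_operator T : Prop :=
  [/\ linear_operator T, closed_operator T, densely_defined T &
      op_eq (op_comp T (adjoint T)) (op_comp (adjoint T) T)].

Definition bounded_map (B : H -> H) : Prop :=
  exists M : R, forall y, hnorm (B y) <= M * hnorm y.

Definition resolvent_set S : set R[i] :=
  [set z | set_bij (opdom S) setT (fun x => S x - z *: x) /\
           exists2 B : H -> H,
             (forall x, opdom S x -> B (S x - z *: x) = x) & bounded_map B].

Definition spectrum S : set R[i] := ~` resolvent_set S.

End Operators.

(* Main.v *)
Require Import Defs.
From mathcomp Require Import all_boot all_order all_algebra sesquilinear.
From mathcomp Require Import all_classical all_reals all_analysis.
From mathcomp Require Import complex.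
From mathcomp Require Import ring lra.

Set Implicit Arguments.
Unset Strict Implicit.
Unset Printing Implicit Defensive.

Import Order.TTheory GRing.Theory Num.Theory.
Import numFieldNormedType.Exports.
Local Open Scope classical_set_scope.
Local Open Scope complex_scope.
Local Open Scope ring_scope.

(** Put [N := T - z] for a [z] in the narrowed strip, and choose [d] strictly
    between [c * m] and the distance from [Re z] to the pair [alpha], [beta]. The operator [T + A] is treated as a relatively bounded
    perturbation of [N]: it suffices to find [q < 1] with
    [|A x| <= q |N x|] on the domain of [T], since then [1 + A N^-1] is inverted
    by iteration of a contraction ([resolvent_perturbation]). In view of the
    bound on [|A x|], this follows with [q = c m / d] from

      [d |x| <= |N x|]   and   [d |T x| <= M |N x|],

    [M] being the larger of [|alpha + i gamma|] and [|beta + i gamma|]. For a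
    normal operator these are spectral statements: they hold as soon as
    [d <= |t - z|] and [d |t| <= M |t - z|] for every [t] in the spectrum, and
    the latter are elementary plane geometry ([edge_ratio]).

    The transfer from the spectrum to the operator uses no spectral theorem.
    Everything is reduced to one fact, [normal_gap]: if the open disc of centre
    [w] and radius [r] lies in the resolvent set, then [r |x| <= |(T - w) x|].
    The first estimate is a direct instance. For the second, the set where
    [|t| > k |t - z|] (with [k = M / d > 1]) is a disc of Apollonius, and the
    identity that says so holds verbatim when [t] is replaced by [T] and the
    square of the modulus by the square of the norm ([spectrum_ratio]).

    [normal_gap] is a form of the equality of norm and spectral radius for the
    normal operator [B = (T - w)^-1]. Normality enters as log-convexity of
    [k |-> |B^k v|] ([normal_log_convex]): a vector that [B] stretches almost
    by its norm [L] is stretched by almost [L^k] by [B^k]. If [1 / L < r], the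
    circle of radius [1 / L] about [w] is a compact subset of the resolvent
    set, so [T - w - zeta / L] is bounded below uniformly for [|zeta| = 1]
    ([circle_bound]); applied to [sum_(k < n) (zeta / L)^k B^(k+1) v] this
    bounds that sum independently of [n] and [zeta], by telescoping
    ([resolvent_partial_sum]). But by orthogonality of characters some [zeta]
    makes its square at least the sum of the squares of its terms
    ([exists_phase]), which grows linearly in [n].

    Finally, log-convexity needs [|T^* x| = |T x|] on the domain of [T]
    ([normal_adjoint]). On the domain of [T^* T = T T^*] this is a direct
    computation; it extends because that domain is a core of [T]
    ([core_TsT]), itself a consequence of the surjectivity of [1 + T^* T]
    ([onto_1_plus_TsT]), both obtained by orthogonal projection in [H * H]. *)

(** * Real-valued norm and real inner product *)

Section HilbertNorm.
Variables (R : realType) (H : completeNormedModType R[i]).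
Implicit Types (x y : H).

Lemma normE x : `|x| = (hnorm x)%:C.
Proof. by rewrite /hnorm RRe_real // normr_real. Qed.

Lemma cabsE (z : R[i]) : `|z| = (cabs z)%:C.
Proof. by rewrite /cabs RRe_real // normr_real. Qed.

Lemma hnorm_ge0 x : 0 <= hnorm x.
Proof. by rewrite -lecR -normE normr_ge0. Qed.

Lemma cabs_ge0 (z : R[i]) : 0 <= cabs z.
Proof. by rewrite -lecR -cabsE normr_ge0. Qed.

Lemma hnormD x y : hnorm (x + y) <= hnorm x + hnorm y.
Proof. by rewrite -lecR rmorphD /= -!normE ler_normD. Qed.

Lemma hnormN x : hnorm (- x) = hnorm x.
Proof. by rewrite /hnorm normrN. Qed.

Lemma hnormB x y : hnorm (x - y) = hnorm (y - x).
Proof. by rewrite /hnorm distrC. Qed.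

Lemma hnorm_triangle y x z : hnorm (x - z) <= hnorm (x - y) + hnorm (y - z).
Proof. by rewrite -{1}(subrK y x) -addrA hnormD. Qed.

Lemma hnorm0 : hnorm (0 : H) = 0.
Proof. by rewrite /hnorm normr0. Qed.

Lemma hnorm_eq0 x : hnorm x = 0 -> x = 0.
Proof. by move=> h; apply/normr0_eq0; rewrite normE h. Qed.

Lemma hnormZ (a : R[i]) x : hnorm (a *: x) = cabs a * hnorm x.
Proof. by apply: complexI; rewrite rmorphM /= -normE normrZ normE cabsE. Qed.

Lemma cabsM (a b : R[i]) : cabs (a * b) = cabs a * cabs b.
Proof. by apply: complexI; rewrite rmorphM /= -!cabsE normrM. Qed.

Lemma cabsD (a b : R[i]) : cabs (a + b) <= cabs a + cabs b.
Proof. by rewrite -lecR rmorphD /= -!cabsE ler_normD. Qed.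

Lemma cabs_sqr (z : R[i]) : cabs z ^+ 2 = complex.Re z ^+ 2 + complex.Im z ^+ 2.
Proof. by apply: complexI; rewrite rmorphXn /= -cabsE -add_Re2_Im2. Qed.

Lemma cabs_real (t : R) : cabs t%:C = `|t|.
Proof.
apply/eqP; rewrite -(@eqrXn2 _ 2%N) ?cabs_ge0 // cabs_sqr /= expr0n addr0.
by rewrite real_normK ?num_real.
Qed.

End HilbertNorm.

Section RealInnerProduct.
Variables (R : realType) (H : completeNormedModType R[i]).
Variable dot : {dot H for @Num.conj R[i]}.
Hypothesis hdot : induces_norm dot.
Implicit Types (x y z : H).

(** The real part makes [H] a real inner product space with the same norm, so
    that estimates become inequalities between reals; [dot_ext] recovers the
    complex form. *)
Definition rdot x y : R := complex.Re (dot x y).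

Lemma ReD (a b : R[i]) : complex.Re (a + b) = complex.Re a + complex.Re b.
Proof. by case: a; case: b. Qed.
Lemma ReN (a : R[i]) : complex.Re (- a) = - complex.Re a.
Proof. by case: a. Qed.

Lemma dotC x y : dot x y = (dot y x)^*%C.
Proof. by rewrite hermC expr0 mul1r. Qed.

Lemma rdotC x y : rdot x y = rdot y x.
Proof. by rewrite /rdot dotC; case: (dot y x). Qed.

Lemma rdotDl x y z : rdot (x + y) z = rdot x z + rdot y z.
Proof. by rewrite /rdot linearDl ReD. Qed.
Lemma rdotNl x z : rdot (- x) z = - rdot x z.
Proof. by rewrite /rdot linearNl ReN. Qed.
Lemma rdotDr x y z : rdot z (x + y) = rdot z x + rdot z y.
Proof. by rewrite !(rdotC z) rdotDl. Qed.
Lemma rdotNr x z : rdot z (- x) = - rdot z x.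
Proof. by rewrite !(rdotC z) rdotNl. Qed.

Lemma rdotZ (w : R[i]) x y : rdot (w *: x) y = rdot x (w^*%C *: y).
Proof.
rewrite /rdot linearZl_LR linearZr_LR /=.
congr (complex.Re (_ * _)); exact/esym/conjcK.
Qed.

Lemma rdotZl (t : R) x y : rdot (t%:C *: x) y = t * rdot x y.
Proof. by rewrite /rdot linearZl_LR /=; case: (dot x y) => a b /=; ring. Qed.
Lemma rdotZr (t : R) x y : rdot y (t%:C *: x) = t * rdot y x.
Proof. by rewrite !(rdotC y) rdotZl. Qed.

Lemma rdotxx x : rdot x x = hnorm x ^+ 2.
Proof. by rewrite /rdot -hdot normE -rmorphXn. Qed.

Lemma hnorm_sqrD x y :
  hnorm (x + y) ^+ 2 = hnorm x ^+ 2 + 2 * rdot x y + hnorm y ^+ 2.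
Proof. by rewrite -!rdotxx !(rdotDl, rdotDr) (rdotC y x); ring. Qed.

Lemma hnorm_sqrB x y :
  hnorm (x - y) ^+ 2 = hnorm x ^+ 2 - 2 * rdot x y + hnorm y ^+ 2.
Proof. by rewrite hnorm_sqrD rdotNr hnormN; ring. Qed.

Lemma cauchy_schwarz x y : `|rdot x y| <= hnorm x * hnorm y.
Proof.
have CS u v : rdot u v <= hnorm u * hnorm v.
  have : hnorm (u + v) ^+ 2 <= (hnorm u + hnorm v) ^+ 2.
    by rewrite lerXn2r ?nnegrE ?addr_ge0 ?hnorm_ge0 // hnormD.
  by rewrite hnorm_sqrD; nra.
by rewrite ler_norml CS andbT lerNl -rdotNl -(hnormN x) CS.
Qed.

(** Real parts determine the form once the first argument may be multiplied by
    complex scalars: the imaginary part shows up as the real part at [i x]. *)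
Lemma dot_ext x y x' y' :
  (forall w : R[i], rdot (w *: x) y = rdot (w *: x') y') -> dot x y = dot x' y'.
Proof.
move=> e; have := e 1; have := e 'i%C; rewrite /rdot !linearZl_LR /= !mul1r.
by case: (dot x y); case: (dot x' y') => a b c d /= e1 ->; congr (_ +i* _); lra.
Qed.

(** Completeness with an explicit rate: keeping the same [b] for the limit makes
    every later passage to the limit an instance of [le0_rate]. *)
Lemma cauchy_rate (u : nat -> H) (b : nat -> R) :
  (forall n m, (n <= m)%N -> hnorm (u n - u m) <= b n) -> b @ \oo --> 0 ->
  exists l, forall n, hnorm (u n - l) <= b n.
Proof.
move=> hu /cvgrPdist_lt cb.
have cu : cvgn u.
  apply/cauchy_cvgP; apply/cauchy_exP => e e0.
  have ee : (complex.Re e)%:C = e by rewrite RRe_real // realE ltW.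
  have e0' : 0 < complex.Re e by rewrite -ltcR ee.
  have [N _ hN] := cb _ e0'.
  exists (u N), N => // m /= Nm.
  rewrite -ball_normE /= normE -ee ltcR (le_lt_trans (hu _ _ Nm)) //.
  by apply: le_lt_trans (hN N (leqnn N)); rewrite sub0r normrN ler_norm.
exists (lim (u @ \oo)) => n; apply/ler_addgt0Pr => e e0.
have /cvgrPdist_lt/(_ e%:C) := cu.
rewrite ltcR => /(_ e0)[N _ hN].
have := hN (maxn n N) (leq_maxr _ _); rewrite normE ltcR (hnormB (lim _)) => h.
rewrite (le_trans (hnorm_triangle (u (maxn n N)) _ _)) //.
by apply: lerD; [apply: hu; exact: leq_maxl | exact: ltW].
Qed.

Lemma closed_rate (S : set (H * H)) (u v : nat -> H) (b : nat -> R) x y :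
  closed S -> b @ \oo --> 0 -> (forall n, S (u n, v n)) ->
  (forall n, hnorm (u n - x) <= b n) -> (forall n, hnorm (v n - y) <= b n) ->
  S (x, y).
Proof.
move=> cS /cvgrPdist_lt cb Suv hu hv.
have cvgH (w : nat -> H) l : (forall n, hnorm (w n - l) <= b n) -> w @ \oo --> l.
  move=> hw; apply/cvgrPdist_lt => e e0.
  have ee : (complex.Re e)%:C = e by rewrite RRe_real // realE ltW.
  have e0' : 0 < complex.Re e by rewrite -ltcR ee.
  have [N _ hN] := cb _ e0'.
  exists N => // n /= /hN; rewrite sub0r normrN => h.
  rewrite normE -ee ltcR hnormB (le_lt_trans (hw n)) // (le_lt_trans _ h) //.
  exact: ler_norm.
have nS : \forall n \near \oo, S (u n, v n) by exact: nearW.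
apply: (@closed_cvg _ (H * H)%type \oo _ (fun n => (u n, v n)) S cS nS).
exact: cvg_pair (cvgH _ _ hu) (cvgH _ _ hv).
Qed.

Lemma le0_rate (b : nat -> R) (a c : R) :
  b @ \oo --> 0 -> (forall n, a <= c * b n) -> a <= 0.
Proof.
move=> cb h.
have : (c * b n) @[n --> \oo] --> c * 0 by apply: cvgMr.
rewrite mulr0 => /cvgrPdist_lt/= cc; apply/ler_addgt0Pr => e /cc[N _ hN].
have := hN N (leqnn N); rewrite sub0r normrN => h2.
by rewrite add0r (le_trans (h N)) // ltW // (le_lt_trans _ h2) // ler_norm.
Qed.

End RealInnerProduct.

(** * Orthogonal projection in the product space *)

Lemma cvg_2harmonic (R : realType) : 2 * harmonic n @[n --> \oo] --> (0 : R).
Proof. by rewrite -(mulr0 2); apply: cvgMr; exact: cvg_harmonic. Qed.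

Section Projection.
Variables (R : realType) (H : completeNormedModType R[i]).
Variable dot : {dot H for @Num.conj R[i]}.
Hypothesis hdot : induces_norm dot.

(** Discriminant bound for an approximate minimum: along a line, a point within
    [e ^+ 2] of the infimum has slope of order [e]. *)
Lemma slope_near_minimum (g q e : R) :
  0 < e -> (forall t, 0 <= e ^+ 2 + 2 * t * g + t ^+ 2 * q) ->
  `|g| <= (1 + q) / 2 * e.
Proof.
move=> e0 h; have := h e; have := h (- e) => h1 h2.
have e2 : 0 <= e * ((1 + q) * e + 2 * g) by nra.
have e1 : 0 <= e * ((1 + q) * e - 2 * g) by nra.
move: e1 e2; rewrite !pmulr_rge0 // => e1 e2.
by rewrite ler_norml; apply/andP; split; lra.
Qed.

(** Projection of [(h, k)] on the closure of the subspace [V] of [H * H]. The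
    norm of [H * H] is a maximum, which is not Hilbertian, so the minimizing
    sequence is that of the sum of squares; it is part of the conclusion
    because [V] need not be closed. *)
Lemma pair_projection (V : H -> H -> Prop) (h k : H) :
  V 0 0 ->
  (forall (a : R[i]) x y x' y', V x y -> V x' y' ->
     V (a *: x + x') (a *: y + y')) ->
  exists x y, exists xs ys : nat -> H,
    [/\ forall n, V (xs n) (ys n),
        forall n, hnorm (xs n - x) <= 2 * harmonic n,
        forall n, hnorm (ys n - y) <= 2 * harmonic n &
        forall u v, V u v -> rdot dot (h - x) u + rdot dot (k - y) v = 0].
Proof.
move=> V0 Vlin.
pose J x y := hnorm (x - h) ^+ 2 + hnorm (y - k) ^+ 2.
pose S := [set r | exists x y, V x y /\ r = J x y].
have S0 : S !=set0 by exists (J 0 0), 0, 0.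
have lbS : has_lbound S.
  by exists 0 => _ [x [y [_ ->]]]; rewrite addr_ge0 ?sqr_ge0.
pose m := inf S.
have mJ x y : V x y -> m <= J x y.
  by move=> Vxy; apply: ge_inf => //; exists x, y.
pose e n : R := harmonic n.
have e0 n : 0 < e n by rewrite /e /= invr_gt0 ltr0n.
have ee i j : (i <= j)%N -> e j <= e i.
  by move=> ij; rewrite /e /= lef_pV2 ?posrE ?ltr0n // ler_nat.
have ex n : exists xy : H * H, V xy.1 xy.2 /\ J xy.1 xy.2 < m + e n ^+ 2.
  have [//|_ [x [y [Vxy ->]]] lt] := @inf_adherent _ S (e n ^+ 2) _ (conj S0 lbS).
    by rewrite exprn_gt0.
  by exists (x, y).
have [xy hxy] := choice ex.
pose xs n := (xy n).1; pose ys n := (xy n).2.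
have VV n : V (xs n) (ys n) by case: (hxy n).
have JJ n : J (xs n) (ys n) < m + e n ^+ 2 by case: (hxy n).
(* The midpoint of two approximate minimizers lies in [V], so its value is at
   least [m]; the parallelogram law then forces the minimizers together. *)
have para (a b : H) : hnorm (a - b) ^+ 2 + 4 * hnorm (2^-1%:C *: (a + b)) ^+ 2
    = 2 * hnorm a ^+ 2 + 2 * hnorm b ^+ 2.
  rewrite hnormZ cabs_real exprMn real_normK ?num_real //.
  by rewrite (hnorm_sqrB hdot) (hnorm_sqrD hdot); field.
have mid (a b c : H) : 2^-1%:C *: ((a - c) + (b - c)) = 2^-1%:C *: a + 2^-1%:C *: b - c.
  rewrite addrACA -opprD scalerBr scalerDr (scalerDr _ c c) -scalerDl -rmorphD /=.
  have -> : 2^-1 + 2^-1 = 1 :> R by lra.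
  by rewrite scale1r.
have sub (a b c : H) : (a - c) - (b - c) = a - b by rewrite opprB addrA subrK.
have cau i j : (i <= j)%N -> hnorm (xs i - xs j) ^+ 2 + hnorm (ys i - ys j) ^+ 2
    <= (2 * e i) ^+ 2.
  move=> ij.
  have Vm : V (2^-1%:C *: xs i + 2^-1%:C *: xs j) (2^-1%:C *: ys i + 2^-1%:C *: ys j).
    apply: (Vlin) => //.
    by rewrite -[_ *: xs j]addr0 -[_ *: ys j]addr0; apply: (Vlin).
  have := mJ _ _ Vm; have := JJ i; have := JJ j.
  have e2 : e j ^+ 2 <= e i ^+ 2 by rewrite lerXn2r ?nnegrE ?(ltW (e0 _)) ?ee.
  rewrite /J -!mid.
  have := para (xs i - h) (xs j - h); have := para (ys i - k) (ys j - k).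
  rewrite !sub; lra.
have cvg2 : 2 * e n @[n --> \oo] --> (0 : R) := @cvg_2harmonic R.
have sq (a b : R) : 0 <= a -> 0 <= b -> a ^+ 2 <= b ^+ 2 -> a <= b.
  by move=> a0 b0; rewrite ler_pXn2r.
have e20 n : 0 <= 2 * e n by rewrite mulr_ge0 // ltW.
have [x hx] : exists x, forall n, hnorm (xs n - x) <= 2 * e n.
  apply: cauchy_rate cvg2 => i j /cau h1; apply: sq; rewrite ?hnorm_ge0 //.
  by apply: le_trans h1; rewrite lerDl sqr_ge0.
have [y hy] : exists y, forall n, hnorm (ys n - y) <= 2 * e n.
  apply: cauchy_rate cvg2 => i j /cau h1; apply: sq; rewrite ?hnorm_ge0 //.
  by apply: le_trans h1; rewrite lerDr sqr_ge0.
exists x, y, xs, ys; split => // u v Vuv.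
set G := LHS.
pose Q := hnorm u ^+ 2 + hnorm v ^+ 2.
pose C := (1 + Q) / 4 + (hnorm u + hnorm v).
have hG n : `|G| <= C * (2 * e n).
  pose Gn := rdot dot (h - xs n) u + rdot dot (k - ys n) v.
  have hGn : `|Gn| <= (1 + Q) / 2 * e n.
    rewrite -normrN; apply: slope_near_minimum => // t.
    have Vt : V (t%:C *: u + xs n) (t%:C *: v + ys n) by apply: (Vlin).
    have := mJ _ _ Vt; have := JJ n; rewrite /J -!addrA !(hnorm_sqrD hdot (_ *: _)).
    rewrite !hnormZ cabs_real !exprMn real_normK ?num_real // !rdotZl.
    rewrite /Gn -(opprB (xs n)) -(opprB (ys n)) !(rdotNl) /Q (rdotC _ u) (rdotC _ v).
    nra.
  have -> : G = Gn + (rdot dot (xs n - x) u + rdot dot (ys n - y) v).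
    by rewrite /G /Gn !(rdotDl, rdotNl); ring.
  have b1 := cauchy_schwarz hdot (xs n - x) u.
  have b2 := cauchy_schwarz hdot (ys n - y) v.
  have c1 : hnorm (xs n - x) * hnorm u <= 2 * e n * hnorm u.
    by rewrite ler_wpM2r ?hnorm_ge0.
  have c2 : hnorm (ys n - y) * hnorm v <= 2 * e n * hnorm v.
    by rewrite ler_wpM2r ?hnorm_ge0.
  apply: (le_trans (ler_normD _ _)); apply: (le_trans (lerD hGn (ler_normD _ _))).
  by rewrite /C; lra.
by apply/eqP; rewrite -normr_le0; apply: le0_rate cvg2 hG.
Qed.

End Projection.

(** * Closed and normal operators *)

Section NormalAdjoint.
Variables (R : realType) (H : completeNormedModType R[i]).
Variable dot : {dot H for @Num.conj R[i]}.
Hypothesis hdot : induces_norm dot.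
Variable T : operator H.

Lemma opdomP (a : R[i]) x y : linear_operator T ->
  opdom T x -> opdom T y -> opdom T (a *: x + y).
Proof. by move=> [_ h] hx hy; case: (h a x y hx hy). Qed.

Lemma opfunP (a : R[i]) x y : linear_operator T ->
  opdom T x -> opdom T y -> T (a *: x + y) = a *: T x + T y.
Proof. by move=> [_ h] hx hy; case: (h a x y hx hy). Qed.

Lemma opfun0 : linear_operator T -> T 0 = 0.
Proof.
move=> hT; have /(congr1 (fun z => z - T 0)) := opfunP 1 hT hT.1 hT.1.
by rewrite scaler0 add0r scale1r addrK subrr.
Qed.

Lemma opdomZ (a : R[i]) x : linear_operator T -> opdom T x -> opdom T (a *: x).
Proof. by move=> hT hx; rewrite -[_ *: _]addr0; apply: opdomP => //; case: hT. Qed.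

Lemma opfunZ (a : R[i]) x : linear_operator T -> opdom T x -> T (a *: x) = a *: T x.
Proof.
move=> hT hx; rewrite -[a *: x]addr0 opfunP //; last by case: hT.
by rewrite opfun0 // addr0.
Qed.

Lemma opdomD x y : linear_operator T -> opdom T x -> opdom T y -> opdom T (x + y).
Proof. by move=> hT hx hy; rewrite -[x]scale1r; apply: opdomP. Qed.

Lemma opfunD x y : linear_operator T -> opdom T x -> opdom T y ->
  T (x + y) = T x + T y.
Proof. by move=> hT hx hy; rewrite -[x in LHS]scale1r opfunP // scale1r. Qed.

Lemma opdomB x y : linear_operator T -> opdom T x -> opdom T y -> opdom T (x - y).
Proof.
move=> hT hx hy; rewrite -(scaleN1r y); apply: (opdomD hT hx).
exact: opdomZ.
Qed.

Lemma opfunB x y : linear_operator T -> opdom T x -> opdom T y ->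
  T (x - y) = T x - T y.
Proof.
move=> hT hx hy; rewrite -(scaleN1r y) -(scaleN1r (T y)).
by rewrite (opfunD hT hx (opdomZ _ hT hy)) (opfunZ _ hT hy).
Qed.

Lemma adjoint_valueP (a : R[i]) y z y' z' :
  adjoint_value dot T y z -> adjoint_value dot T y' z' ->
  adjoint_value dot T (a *: y + y') (a *: z + z').
Proof.
by move=> h h' x hx; rewrite !linearDr !linearZr_LR /= (h x hx) (h' x hx).
Qed.

Lemma adjoint_value_rdot x z : linear_operator T ->
  (forall y, opdom T y -> rdot dot (T y) x = rdot dot y z) -> adjoint_value dot T x z.
Proof.
move=> hT h y hy; apply: dot_ext => w.
by rewrite -(opfunZ w hT hy) (h _ (opdomZ w hT hy)).
Qed.

Lemma adjointP y : opdom (adjoint dot T) y ->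
  adjoint_value dot T y (adjoint dot T y).
Proof. by case=> z hz; exact: (xgetPex 0 (ex_intro _ z hz)). Qed.

(** Surjectivity of [1 + T^* T], for closed [T]: the projection of [(h, 0)] on
    the graph of [T] is [(x, T x)], and orthogonality of the residue
    [(h - x, - T x)] to the graph says that [T^* (T x) = h - x]. *)
Lemma onto_1_plus_TsT h : linear_operator T -> closed_operator T ->
  exists2 x, opdom T x & adjoint_value dot T (T x) (h - x).
Proof.
move=> hT cT.
have [|a x y x' y' [hx ->] [hx' ->]|x [y [xs [ys [hV cx cy orth]]]]] :=
  @pair_projection _ _ _ hdot (fun x y => opdom T x /\ y = T x) h 0.
- by case: (hT) => T0 _; rewrite opfun0.
- by split; [apply: opdomP | rewrite opfunP].
have [hx /= yE] : opdom T x /\ y = T x.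
  have c2 := @cvg_2harmonic R.
  exact: (closed_rate cT c2 hV cx cy).
exists x => //; apply: adjoint_value_rdot => // u hu.
have := orth u (T u) (conj hu erefl).
by rewrite yE sub0r rdotNl => /subr0_eq e; rewrite rdotC -e rdotC.
Qed.

(** The domain of [T^* T] is a core of [T]. If [(e, T e)] is orthogonal to the
    graph of [T] restricted to that domain, then [e] is orthogonal to the range
    of [1 + T^* T], which is everything. *)
Lemma core_TsT x : linear_operator T -> closed_operator T -> opdom T x ->
  exists xs : nat -> H,
    [/\ forall n, opdom T (xs n) /\ opdom (adjoint dot T) (T (xs n)),
        forall n, hnorm (xs n - x) <= 2 * harmonic n &
        forall n, hnorm (T (xs n) - T x) <= 2 * harmonic n].
Proof.
move=> hT cT hx.
have [|a u v u' v' [hu tu ->] [hu' tu' ->]|a [b [xs [ys [hV cx cy orth]]]]] :=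
  @pair_projection _ _ _ hdot (fun u v =>
    [/\ opdom T u, opdom (adjoint dot T) (T u) & v = T u]) x (T x).
- split; [by case: hT| |by rewrite opfun0].
  by exists 0 => u _; rewrite opfun0 // !linear0r.
- split; [exact: opdomP| |by rewrite opfunP].
  case: tu tu' => z hz [z' hz']; exists (a *: z + z').
  by rewrite opfunP //; apply: adjoint_valueP.
have [ha /= bE] : opdom T a /\ b = T a.
  have c2 := @cvg_2harmonic R.
  by apply: (closed_rate cT c2 _ cx cy) => n /=; case: (hV n).
have [u hu au] := onto_1_plus_TsT (x - a) hT cT.
have xa : x - a = 0.
  have hxa : opdom T (x - a) by apply: opdomB.
  have au' : rdot dot (T (x - a)) (T u) = rdot dot (x - a) (x - a - u).
    by rewrite /rdot au.
  have := orth u (T u); rewrite bE -(opfunB hT hx ha) au' -rdotDr (addrC u) subrK.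
  rewrite (rdotxx hdot) => h.
  apply/hnorm_eq0/eqP; rewrite -sqrf_eq0; apply/eqP/h; split=> //.
  by eexists; exact: au.
have {xa} xa : a = x by apply/esym/subr0_eq.
exists xs; split => n.
- by case: (hV n).
- by rewrite -xa.
- by case: (hV n) => _ _ <-; rewrite -xa -bE.
Qed.

(** On the domain of [T^* T = T T^*] one has
    [<T^* u, T^* v> = <T T^* u, v> = <T^* T u, v> = <T u, T v>]. Approximating
    [x] from this core, the vectors [T^* (xs n)] are as close to each other as the
    [T (xs n)], so they converge, and their limit is a value of the adjoint. *)
Lemma normal_adjoint x : normal_operator dot T -> opdom T x ->
  exists2 z, adjoint_value dot T x z & hnorm z = hnorm (T x).
Proof.
case=> hT cT _ [domE valE] hx.
have iso u v : opdom T u -> opdom (adjoint dot T) (T u) ->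
    opdom T v -> opdom (adjoint dot T) (T v) ->
    adjoint_value dot T u (adjoint dot T u) /\
    rdot dot (adjoint dot T u) (adjoint dot T v) = rdot dot (T u) (T v).
  move=> hu tu hv tv.
  have du : opdom (op_comp T (adjoint dot T)) u by rewrite domE.
  have dv : opdom (op_comp T (adjoint dot T)) v by rewrite domE.
  case: (du) => /= au Tau; case: (dv) => /= av _.
  split; first exact: adjointP.
  have TauE : T (adjoint dot T u) = adjoint dot T (T u) := valE u du.
  rewrite /rdot -(adjointP av) // TauE.
  by rewrite dotC -(adjointP tu) // -dotC.
have [xs [hxs cx cT']] := core_TsT hT cT hx.
have c2 := @cvg_2harmonic R.
pose zs n := adjoint dot T (xs n).
have isoN n : hnorm (zs n) = hnorm (T (xs n)).
  have [h1 h2] := hxs n; have [_] := iso _ _ h1 h2 h1 h2.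
  by rewrite !(rdotxx hdot) => /eqP; rewrite eqrXn2 ?hnorm_ge0 // => /eqP.
have isoB n m : hnorm (zs n - zs m) = hnorm (T (xs n) - T (xs m)).
  apply/eqP; rewrite -(@eqrXn2 _ 2%N) ?hnorm_ge0 // !(hnorm_sqrB hdot) !isoN.
  have [h1 h2] := hxs n; have [h3 h4] := hxs m.
  by have [_ ->] := iso _ _ h1 h2 h3 h4.
have c4 : 2 * (2 * harmonic n) @[n --> \oo] --> (0 : R).
  by rewrite -(mulr0 2); apply: cvgMr.
have [z hz] : exists z, forall n, hnorm (zs n - z) <= 2 * (2 * harmonic n).
  apply: cauchy_rate c4 => n m nm; rewrite isoB.
  rewrite (le_trans (hnorm_triangle (T x) _ _)) // (hnormB (T x)).
  have hm : harmonic m <= harmonic n :> R.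
    by rewrite /= lef_pV2 ?posrE ?ltr0n // ler_nat.
  have := cT' n; have := cT' m; move: hm.
  move: (harmonic m : R) (harmonic n : R) => em en; lra.
exists z.
- apply: adjoint_value_rdot => // y hy.
  apply/eqP; rewrite -subr_eq0 -normr_le0.
  apply: (le0_rate (c := hnorm (T y) + 2 * hnorm y) c2) => n.
  have -> : rdot dot (T y) x - rdot dot y z =
      rdot dot y (zs n - z) - rdot dot (T y) (xs n - x).
    have [h1 h2] := hxs n; have [av _] := iso _ _ h1 h2 h1 h2.
    have avE : rdot dot (T y) (xs n) = rdot dot y (zs n) by rewrite /rdot av.
    by rewrite !(rdotDr, rdotNr) avE; ring.
  have b1 := cauchy_schwarz hdot y (zs n - z).
  have b2 := cauchy_schwarz hdot (T y) (xs n - x).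
  have b3 := ler_wpM2l (hnorm_ge0 y) (hz n).
  have b4 := ler_wpM2l (hnorm_ge0 (T y)) (cx n).
  by apply: (le_trans (ler_normB _ _)); lra.
- apply/eqP; rewrite -subr_eq0 -normr_le0.
  apply: (le0_rate (c := 3) c2) => n.
  have -> : hnorm z - hnorm (T x) =
      (hnorm z - hnorm (zs n)) + (hnorm (T (xs n)) - hnorm (T x)).
    by rewrite isoN; ring.
  have dist (u v : H) : `|hnorm u - hnorm v| <= hnorm (u - v).
    have t1 := hnormD (u - v) v; have t2 := hnormD (v - u) u.
    move: t1 t2; rewrite !subrK (hnormB v) ler_norml => ? ?.
    by apply/andP; split; lra.
  have b1 := dist z (zs n); have b2 := dist (T (xs n)) (T x).
  have := hz n; rewrite hnormB => b3; have b4 := cT' n.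
  by apply: (le_trans (ler_normD _ _)); lra.
Qed.

End NormalAdjoint.

(** * The unit circle *)

Section Circle.
Variables (R : realType) (H : completeNormedModType R[i]).
Variable dot : {dot H for @Num.conj R[i]}.
Hypothesis hdot : induces_norm dot.

Definition expi (t : R) : R[i] := cos t +i* sin t.

Lemma cabs_expi t : cabs (expi t) = 1.
Proof.
by apply/eqP; rewrite -(@eqrXn2 _ 2%N) ?cabs_ge0 // cabs_sqr /= cos2Dsin2 expr1n.
Qed.

Lemma cabs_le_ReIm (z : R[i]) : cabs z <= `|complex.Re z| + `|complex.Im z|.
Proof.
rewrite -(@ler_pXn2r _ 2%N) ?nnegrE ?cabs_ge0 ?addr_ge0 // cabs_sqr sqrrD.
by rewrite !real_normK ?num_real // -addrA lerD2l lerDr mulrn_wge0 // mulr_ge0.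
Qed.

Lemma expi_half t : expi (t / 2) ^+ 2 = expi t.
Proof.
rewrite expr2 {3}(splitr t) /expi; apply/eqP; rewrite eq_complex /= cosD sinD.
by apply/andP; split; apply/eqP; ring.
Qed.

Lemma expiDpi t : expi (t + pi) = - expi t.
Proof. by rewrite /expi cosDpi sinDpi. Qed.

Lemma sum_nat_split_parity (V : nmodType) (f : nat -> V) n :
  \sum_(0 <= k < n.*2) f k =
  \sum_(0 <= k < n) f k.*2 + \sum_(0 <= k < n) f k.*2.+1.
Proof.
elim: n => [|n IH]; first by rewrite !big_geq // addr0.
by rewrite doubleS !big_nat_recr //= IH -!addrA; congr (_ + _); rewrite addrCA.
Qed.

(** Among the [2 ^ m]-th roots of unity the mean of the right-hand side is the
    left-hand side (Parseval), so one root does at least as well. The proof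
    halves the sum: splitting into even and odd indices gives
    [E (zeta^2) + zeta O (zeta^2)], and by the parallelogram law one of
    the square roots [zeta], [- zeta] of a good [zeta^2] is good. The family is
    there for the induction, where [E] and [O] must be served by one phase. *)
Lemma exists_phase (m : nat) (fam : seq (nat -> H)) :
  exists2 t, 0 <= t <= 2 * pi &
   \sum_(a <- fam) \sum_(0 <= k < 2 ^ m) hnorm (a k) ^+ 2 <=
   \sum_(a <- fam) hnorm (\sum_(0 <= k < 2 ^ m) expi t ^+ k *: a k) ^+ 2.
Proof.
have pi0 := pi_ge0 R.
elim: m fam => [|m IH] fam.
  exists 0; first by rewrite lexx /=; lra.
  rewrite le_eqVlt; apply/orP; left; apply/eqP.
  by apply: eq_bigr => a _; rewrite !big_nat1 expr0 scale1r.
pose E (a : nat -> H) k := a k.*2; pose O (a : nat -> H) k := a k.*2.+1.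
have [t /andP[t0 t1]] := IH (map E fam ++ map O fam).
rewrite !big_cat !big_map /= -!big_split /=.
set S := (X in _ <= X) => hS.
have split_sum z (a : nat -> H) : z ^+ 2 = expi t ->
    \sum_(0 <= k < 2 ^ m.+1) z ^+ k *: a k =
    \sum_(0 <= k < 2 ^ m) expi t ^+ k *: E a k
    + z *: \sum_(0 <= k < 2 ^ m) expi t ^+ k *: O a k.
  move=> zt.
  have zk k : z ^+ k.*2 = expi t ^+ k by rewrite -mul2n exprM zt.
  rewrite expnS mul2n sum_nat_split_parity scaler_sumr; congr (_ + _).
    by apply: eq_bigr => k _; rewrite zk.
  by apply: eq_bigr => k _; rewrite scalerA exprS zk.
have split_norm : \sum_(a <- fam) \sum_(0 <= k < 2 ^ m.+1) hnorm (a k) ^+ 2 =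
    \sum_(a <- fam) (\sum_(0 <= k < 2 ^ m) hnorm (E a k) ^+ 2 +
                     \sum_(0 <= k < 2 ^ m) hnorm (O a k) ^+ 2).
  by apply: eq_bigr => a _; rewrite expnS mul2n sum_nat_split_parity.
rewrite split_norm.
pose F s := \sum_(a <- fam) hnorm (\sum_(0 <= k < 2 ^ m.+1) expi s ^+ k *: a k) ^+ 2.
have FF : F (t / 2) + F (t / 2 + pi) = 2 * S.
  rewrite /F -big_split /S mulr_sumr /=; apply: eq_bigr => a _.
  rewrite !split_sum ?expiDpi ?sqrrN ?expi_half //.
  rewrite scaleNr (hnorm_sqrB hdot) (hnorm_sqrD hdot) hnormZ cabs_expi mul1r.
  by ring.
have [le|lt] := leP S (F (t / 2)).
  exists (t / 2); first by apply/andP; split; lra.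
  exact: le_trans hS le.
exists (t / 2 + pi); first by apply/andP; split; lra.
by apply: (le_trans hS); rewrite -/(F _); lra.
Qed.

End Circle.

(** * Lower bounds at points of the resolvent set *)

Section Resolvent.
Variables (R : realType) (H : completeNormedModType R[i]).
Variable dot : {dot H for @Num.conj R[i]}.
Hypothesis hdot : induces_norm dot.
Variable T : operator H.
Hypothesis lT : linear_operator T.

Lemma resolvent_bound w : resolvent_set T w ->
  exists2 K, 0 < K & forall x, opdom T x -> hnorm x <= K * hnorm (T x - w *: x).
Proof.
case=> _ [B BK [M hM]]; exists (`|M| + 1); first by rewrite ltr_pwDr.
move=> x hx; rewrite -{1}(BK x hx) (le_trans (hM _)) //.
by rewrite ler_wpM2r ?hnorm_ge0 // (le_trans (ler_norm _)) // lerDl.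
Qed.

Lemma resolvent_inverse w : resolvent_set T w ->
  exists B : H -> H, forall y, opdom T (B y) /\ T (B y) - w *: B y = y.
Proof.
case=> -[_ _ surj] _.
have ex y : exists x, opdom T x /\ T x - w *: x = y.
  by have [x hx <-] := surj y I; exists x.
by have [B hB] := choice ex; exists B.
Qed.

Lemma resolvent_bound_near w : resolvent_set T w ->
  exists2 K, 0 < K & forall w', cabs (w' - w) < K^-1 ->
    forall x, opdom T x -> hnorm x <= K * hnorm (T x - w' *: x).
Proof.
case/resolvent_bound => K K0 hK; exists (2 * K); first by lra.
move=> w' hw x hx; have := hK x hx.
have -> : T x - w *: x = (T x - w' *: x) + (w' - w) *: x.
  by rewrite scalerBl addrA subrK.
move=> h; have h1 := hnormD (T x - w' *: x) ((w' - w) *: x).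
rewrite hnormZ in h1.
have h2 : K * (cabs (w' - w) * hnorm x) <= hnorm x / 2.
  have hw1 : cabs (w' - w) * (2 * K) < 1 by rewrite -ltr_pdivlMr ?mul1r ?mulr_gt0.
  have : 0 <= (1 - cabs (w' - w) * (2 * K)) * hnorm x.
    by rewrite mulr_ge0 ?hnorm_ge0 // subr_ge0 ltW.
  lra.
have h3 := ler_wpM2l (ltW K0) h1; rewrite mulrDr in h3; lra.
Qed.

(** Bounds near each point of the circle become one bound by compactness of the
    segment of angles. *)
Lemma circle_bound w d :
  (forall t, resolvent_set T (w + d%:C * expi t)) ->
  exists2 K, 0 < K & forall t, 0 <= t <= 2 * pi ->
    forall x, opdom T x -> hnorm x <= K * hnorm (T x - (w + d%:C * expi t) *: x).
Proof.
move=> hc.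
pose P K t := 0 < K /\ forall x, opdom T x ->
  hnorm x <= K * hnorm (T x - (w + d%:C * expi t) *: x).
have /compact_near_coveringP cov := @segment_compact R 0 (2 * pi).
have := cov R (pinfty_nbhs R) P _ _; case.
  move=> t _; have [K K0 hK] := resolvent_bound_near (hc t).
  pose e := K^-1 / 2 / (`|d| + 1).
  have d1 : 0 < `|d| + 1 by rewrite ltr_pwDr.
  have e0 : 0 < e by rewrite !divr_gt0 // invr_gt0.
  have cc : \forall s \near t, `|cos t - cos s| < e.
    by have /cvgrPdist_lt := @continuous_cos R t; apply.
  have cs : \forall s \near t, `|sin t - sin s| < e.
    by have /cvgrPdist_lt := @continuous_sin R t; apply.
  exists ([set s | `|cos t - cos s| < e /\ `|sin t - sin s| < e], [set M | K < M]).
    split; first by apply: filterI.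
    by exists K; split; rewrite ?num_real.
  move=> [s M] /= [[hs1 hs2] KM]; split; first exact: lt_trans KM.
  move=> x hx; apply: (@le_trans _ _ (K * hnorm (T x - (w + d%:C * expi s) *: x))).
    apply: hK => //.
    have -> : w + d%:C * expi s - (w + d%:C * expi t) = d%:C * (expi s - expi t).
      by rewrite opprD addrACA subrr add0r -mulrBr.
    rewrite cabsM cabs_real.
    have ce : cabs (expi s - expi t) <= 2 * e.
      apply: (le_trans (cabs_le_ReIm _)).
      rewrite /= (distrC (cos s)) (distrC (sin s)); lra.
    apply: (le_lt_trans (ler_wpM2l (normr_ge0 d) ce)).
    have -> : `|d| * (2 * e) = K^-1 * (`|d| / (`|d| + 1)).
      by rewrite /e; field; rewrite !gt_eqF.
    by rewrite gtr_pMr ?invr_gt0 // ltr_pdivrMr // mul1r ltrDl.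
  by rewrite ler_wpM2r ?hnorm_ge0 // ltW.
move=> K [_ hK].
have KK : K < `|K| + 1 by rewrite (le_lt_trans (ler_norm _)) // ltrDl.
exists (`|K| + 1); first by rewrite ltr_pwDr.
move=> t t01; have [|_] := hK _ KK t; first by rewrite /= in_itv.
exact.
Qed.
End Resolvent.

(** * Discs in the resolvent set of a normal operator *)

Section Gap.
Variables (R : realType) (H : completeNormedModType R[i]).
Variable dot : {dot H for @Num.conj R[i]}.
Hypothesis hdot : induces_norm dot.
Variable T : operator H.
Hypothesis nT : normal_operator dot T.

Let lT : linear_operator T. Proof. by case: nT. Qed.

(** [z] is the value of [(T - w)^*] at [u]: normality passes from [T] to
    [T - w], as expanding both squares shows. *)
Lemma normal_shift_adjoint w u : opdom T u ->
  exists2 z, hnorm z = hnorm (T u - w *: u) &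
    forall x, opdom T x -> rdot dot (T x - w *: x) u = rdot dot x z.
Proof.
move=> hu; have [z hz nz] := normal_adjoint hdot nT hu.
have hzr x : opdom T x -> rdot dot (T x) u = rdot dot x z.
  by move=> hx; rewrite /rdot hz.
exists (z - w^*%C *: u).
  apply/eqP; rewrite -(@eqrXn2 _ 2%N) ?hnorm_ge0 // !(hnorm_sqrB hdot) nz.
  have -> : hnorm (w^*%C *: u) = hnorm (w *: u).
    by rewrite !hnormZ /cabs normcJ.
  have -> // : rdot dot z (w^*%C *: u) = rdot dot (T u) (w *: u).
  rewrite rdotC -(hzr _ (opdomZ _ lT hu)) (opfunZ _ lT hu) rdotZ.
  congr (rdot dot _ (_ *: _)); exact: conjcK.
by move=> x hx; rewrite !(rdotDl, rdotDr, rdotNl, rdotNr) hzr // rdotZ.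
Qed.

(** With [B = (T - w)^-1], [u = B y] and [x = B (B y)], this is
    [|B y|^2 <= |B (B y)| |y|]. Moving [T - w] to the other side of
    [<(T - w) x, u>] produces a vector of the same norm as [(T - w) u]. *)
Lemma normal_log_convex w x u : opdom T x -> opdom T u -> T x - w *: x = u ->
  hnorm u ^+ 2 <= hnorm x * hnorm (T u - w *: u).
Proof.
move=> hx hu e; have [z <- hz] := normal_shift_adjoint w hu.
rewrite -(rdotxx hdot) -{1}e hz //.
exact: le_trans (ler_norm _) (cauchy_schwarz hdot _ _).
Qed.

Lemma log_convex_growth (b : nat -> R) s : 0 <= s -> (forall k, 0 <= b k) ->
  (forall k, b k.+1 ^+ 2 <= b k.+2 * b k) -> s * b 0%N <= b 1%N ->
  forall k, s ^+ k * b 0%N <= b k.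
Proof.
move=> s0 b0 lc h1.
have step k : s * b k <= b k.+1.
  elim: k => // k IH.
  have [bk0|bk] := leP (b k) 0.
    have bE : b k = 0 by apply/eqP; rewrite eq_le bk0 b0.
    have := lc k; rewrite bE mulr0 => h.
    have -> : b k.+1 = 0 by apply/eqP; rewrite -sqrf_eq0 eq_le h sqr_ge0.
    by rewrite mulr0.
  rewrite -(ler_pM2r bk); apply: le_trans (lc k).
  by rewrite expr2 mulrAC ler_wpM2r.
elim=> [|k IH]; first by rewrite expr0 mul1r.
by apply: le_trans (step k); rewrite exprS -mulrA ler_wpM2l.
Qed.

Lemma bernoulli (h : R) n : 0 <= h <= 1 -> 1 - n%:R * h <= (1 - h) ^+ n.
Proof.
move=> /andP[h0 h1]; elim: n => [|n IH]; first by rewrite mul0r subr0 expr0.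
have h1' : 0 <= 1 - h by rewrite subr_ge0.
rewrite exprSr; apply: le_trans (ler_wpM2r h1' IH).
rewrite -natr1; have : 0 <= n%:R * h ^+ 2 by rewrite mulr_ge0 ?sqr_ge0.
lra.
Qed.

(** Telescoping: [x] is a truncated Neumann series for the inverse of
    [T - (w + c)] at [v]. *)
Lemma resolvent_partial_sum w (c : R[i]) (B : H -> H) v n :
  (forall y, opdom T (B y) /\ T (B y) - w *: B y = y) ->
  let x := \sum_(0 <= k < n) c ^+ k *: iter k.+1 B v in
  opdom T x /\ T x - (w + c) *: x = v - c ^+ n *: iter n B v.
Proof.
move=> hB; elim: n => [|n [IHd IH]] /=.
  rewrite !big_geq // scaler0 expr0 scale1r opfun0 // !subrr.
  by split=> //; case: lT.
rewrite !big_nat_recr //=.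
have [hd hN] := hB (iter n B v).
split; first by apply: opdomD => //; apply: opdomZ.
rewrite (opfunD lT IHd (opdomZ _ lT hd)) (opfunZ _ lT hd) scalerDr opprD addrACA IH.
rewrite [in X in _ + X](scalerDl _ w c).
have -> : T (B (iter n B v)) = iter n B v + w *: B (iter n B v).
  by rewrite -[X in X + _]hN subrK.
rewrite scalerDr !scalerA (mulrC w) opprD !addrA exprSr (mulrC c).
by rewrite subrK addrK.
Qed.

(** Equality of norm and spectral radius for [(T - w)^-1]. Take [d = 1 / L] with
    [L] the norm of the inverse [B]. Were [d < r], the sums
    [x = sum_(k < n) c ^ k B^(k+1) v] with [|c| = d] would satisfy
    [|x| <= 2 K |v|] with [K] independent of [n], whereas for a well chosen phase
    of [c] and an almost norming [v] their square is at least
    [n (L / 2)^2 |v|^2]. *)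
Lemma normal_gap w r : (forall w', cabs (w' - w) < r -> resolvent_set T w') ->
  forall x, opdom T x -> r * hnorm x <= hnorm (T x - w *: x).
Proof.
move=> hres x0 hx0; rewrite leNgt; apply/negP => lt0.
have nx0 : 0 < hnorm x0.
  rewrite lt_neqAle hnorm_ge0 andbT eq_sym; apply/eqP => e.
  by move: lt0; rewrite e mulr0 ltNge hnorm_ge0.
have r0 : 0 < r by rewrite -(pmulr_lgt0 _ nx0) (le_lt_trans _ lt0) ?hnorm_ge0.
have rw : resolvent_set T w by apply: hres; rewrite subrr /cabs normr0.
have [K0 K00 hK0] := resolvent_bound rw.
have [B hB] := resolvent_inverse rw.
have hBK y : hnorm (B y) <= K0 * hnorm y.
  by have [hd hN] := hB y; have := hK0 _ hd; rewrite hN.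
pose S := [set q | exists2 y, 0 < hnorm y & q = hnorm (B y) / hnorm y].
pose L := sup S.
have ubS : has_ubound S.
  by exists K0 => _ [y y0 ->]; rewrite ler_pdivrMr.
pose y0 := T x0 - w *: x0.
have ny0 : 0 < hnorm y0.
  by have := lt_le_trans nx0 (hK0 _ hx0); rewrite pmulr_rgt0.
have By0 : B y0 = x0.
  have [hd hN] := hB y0; apply/subr0_eq/hnorm_eq0/eqP.
  rewrite eq_le hnorm_ge0 andbT; have := hK0 _ (opdomB lT hd hx0).
  rewrite (opfunB lT hd hx0) scalerBr opprD opprK addrACA hN.
  by rewrite (addrC (- T x0)) -(opprB (T x0)) subrr hnorm0 mulr0.
have S0 : S !=set0 by exists (hnorm (B y0) / hnorm y0), y0.
have hL y : hnorm (B y) <= L * hnorm y.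
  have [yz|y1] := leP (hnorm y) 0.
    have yE : hnorm y = 0 by apply/eqP; rewrite eq_le yz hnorm_ge0.
    by have := hBK y; rewrite yE !mulr0.
  by rewrite -ler_pdivrMr //; apply: ub_le_sup => //; exists y.
have Lr : 1 < L * r.
  have := hL y0; rewrite By0 => h.
  rewrite -(ltr_pM2r nx0) mul1r -mulrA; apply: (le_lt_trans h).
  rewrite ltr_pM2l //.
  by rewrite -(pmulr_lgt0 _ ny0) (lt_le_trans nx0).
have L0 : 0 < L by rewrite -(pmulr_lgt0 _ r0) (lt_trans _ Lr).
pose d := L^-1.
have d0 : 0 < d by rewrite invr_gt0.
have dL : d * L = 1 by rewrite mulVf ?gt_eqF.
have [|K KK hK] := @circle_bound _ _ T w d.
  move=> t; apply: hres; rewrite addrAC subrr add0r cabsM cabs_expi mulr1.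
  by rewrite cabs_real gtr0_norm // -(ltr_pM2l L0) mulrC dL.
(* [n L^2 / 4 > 4 K^2], so that the two bounds on [x] are incompatible. *)
pose m := Num.bound (16 * K ^+ 2 / L ^+ 2).
pose n := (2 ^ m)%N.
have hm : 16 * K ^+ 2 / L ^+ 2 < n%:R.
  have : 16 * K ^+ 2 / L ^+ 2 < m%:R.
    by apply: archi_boundP; rewrite divr_ge0 ?sqr_ge0 // mulr_ge0 ?sqr_ge0.
  by move=> /lt_trans; apply; rewrite ltr_nat /n ltn_expl.
have n0 : (0 < n)%N by rewrite expn_gt0.
(* [B] stretches [v] by [(1 - eta) L]; this loss, compounded over at most [n]
   steps, costs no more than a factor [1 - n eta = 1 / 2]. *)
pose eta : R := (2 * n%:R)^-1.
have nR : 0 < n%:R :> R by rewrite ltr0n.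
have n1 : 1 <= n%:R :> R by rewrite ler1n.
have eta0 : 0 < eta by rewrite invr_gt0 mulr_gt0.
have etan : n%:R * eta = 2^-1 by rewrite /eta; field; rewrite gt_eqF.
have eta1 : eta <= 1 by nra.
pose s := (1 - eta) * L.
have s0 : 0 <= s by rewrite mulr_ge0 ?subr_ge0 // ltW.
have [v v0 hv] : exists2 v, 0 < hnorm v & s * hnorm v <= hnorm (B v).
  have eL : 0 < eta * L by rewrite mulr_gt0.
  have [_ [v v0 ->] lt] := sup_adherent eL (conj S0 ubS).
  exists v => //; rewrite -ler_pdivlMr //; apply: le_trans (ltW lt).
  by rewrite /s -/L; lra.
pose b k := hnorm (iter k B v).
have growth k : s ^+ k * hnorm v <= b k.
  apply: (@log_convex_growth b) => // [j|j]; first exact: hnorm_ge0.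
  have [h1 e1] := hB (iter j.+1 B v); have [h2 e2] := hB (iter j B v).
  by have := normal_log_convex h1 h2 e1; rewrite e2.
have upper k : b k <= L ^+ k * hnorm v.
  elim: k => [|k IH]; first by rewrite expr0 mul1r.
  apply: (le_trans (hL _)); rewrite exprS -mulrA.
  by rewrite ler_wpM2l // ltW.
have [t t01 ht] := exists_phase hdot m [:: fun k => d%:C ^+ k *: iter k.+1 B v].
rewrite !big_seq1 -/n in ht.
pose c := d%:C * expi t.
have [hxd hxN] := resolvent_partial_sum c v n hB.
set x := (X in opdom T X) in hxd hxN.
have cabsX (z : R[i]) k : cabs (z ^+ k) = cabs z ^+ k.
  by elim: k => [|k IH]; rewrite ?exprS ?cabsM ?IH // expr0 /cabs normr1.
have cc : cabs c = d by rewrite /c cabsM cabs_expi mulr1 cabs_real gtr0_norm.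
have hx2 : hnorm x <= 2 * K * hnorm v.
  apply: (le_trans (hK t t01 _ hxd)); rewrite hxN (mulrC 2) -mulrA.
  apply: ler_wpM2l; first exact: ltW.
  rewrite mulr_natl mulr2n; apply: (le_trans (hnormD _ _)).
  rewrite hnormN hnormZ cabsX cc lerD2l.
  apply: (le_trans (ler_wpM2l (exprn_ge0 n (ltW d0)) (upper n))).
  by rewrite mulrA -exprMn dL expr1n mul1r.
have lower : n%:R * (L / 2 * hnorm v) ^+ 2 <= hnorm x ^+ 2.
  have xE : x = \sum_(0 <= k < n) expi t ^+ k *: (d%:C ^+ k *: iter k.+1 B v).
    by apply: eq_bigr => k _; rewrite scalerA -exprMn mulrC.
  rewrite xE; apply: le_trans ht.
  rewrite mulr_natl -[n in X in X <= _]subn0 -sumr_const_nat.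
  rewrite big_nat [leRHS]big_nat; apply: ler_sum => k /andP[_ kn].
  rewrite lerXn2r ?nnegrE ?hnorm_ge0 ?mulr_ge0 ?divr_ge0 ?hnorm_ge0 ?(ltW L0) //.
  rewrite hnormZ cabsX cabs_real (gtr0_norm d0).
  apply: le_trans (ler_wpM2l (exprn_ge0 k (ltW d0)) (growth k.+1)).
  have -> : d ^+ k * (s ^+ k.+1 * hnorm v) = (1 - eta) ^+ k.+1 * (L * hnorm v).
    have -> : L = (d * L) ^+ k * L by rewrite dL expr1n mul1r.
    rewrite {1}/s exprMn [L ^+ k.+1]exprS [(d * L) ^+ k]exprMn; ring.
  rewrite mulrAC [leLHS]mulrC; apply: ler_wpM2r.
    by rewrite mulr_ge0 ?hnorm_ge0 // ltW.
  apply: le_trans (bernoulli k.+1 _); last by rewrite ltW.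
  have : k.+1%:R * eta <= n%:R * eta by rewrite ler_pM2r // ler_nat.
  rewrite etan; lra.
have x2 : hnorm x ^+ 2 <= (2 * K * hnorm v) ^+ 2.
  by rewrite lerXn2r ?nnegrE ?hnorm_ge0 // !mulr_ge0 ?hnorm_ge0 // ltW.
have := le_trans lower x2; rewrite leNgt => /negP; apply.
have v2 : 0 < hnorm v ^+ 2 by rewrite exprn_gt0.
have -> : (2 * K * hnorm v) ^+ 2 = (16 * K ^+ 2 / L ^+ 2) * (L / 2 * hnorm v) ^+ 2.
  by field; rewrite gt_eqF.
by rewrite ltr_pM2r // exprn_gt0 // mulr_gt0 // divr_gt0.
Qed.
End Gap.

(** * From the spectrum to operator inequalities *)

Section Perturbation.
Variables (R : realType) (H : completeNormedModType R[i]).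
Variable dot : {dot H for @Num.conj R[i]}.
Hypothesis hdot : induces_norm dot.

Lemma spectrum_distance (T : operator H) z d : normal_operator dot T ->
  (forall t, spectrum T t -> d <= cabs (t - z)) ->
  forall x, opdom T x -> d * hnorm x <= hnorm (T x - z *: x).
Proof.
move=> nT hd; apply: (normal_gap hdot nT) => w hw; apply: contrapT => /hd.
by rewrite leNgt hw.
Qed.

(** The locus [|t| = k |t - z|] is the circle of centre [s z] and radius
    [k |z| / (k ^+ 2 - 1)]. Here [a] and [c] stand for [|t|^2] and [|z|^2] and
    [b] for the scalar product of [t] and [z] in the plane, or else [a], [b],
    [c] stand for [|T x|^2], [Re <T x, z x>] and [|z x|^2]. *)
Lemma apollonius (k a b c : R) : k ^+ 2 - 1 != 0 ->
  let s := k ^+ 2 / (k ^+ 2 - 1) in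
  k ^+ 2 * (a - 2 * b + c) - a =
  (k ^+ 2 - 1) * (a - 2 * (s * b) + s ^+ 2 * c - (k / (k ^+ 2 - 1)) ^+ 2 * c).
Proof. by move=> k0 s; rewrite /s; field. Qed.

(** The disc of Apollonius where [|t| > k |t - z|] is free of spectrum, so
    [spectrum_distance] applies at its centre; the conclusion is read back
    through the same identity. *)
Lemma spectrum_ratio (T : operator H) z k : normal_operator dot T -> 1 < k ->
  (forall t, spectrum T t -> cabs t <= k * cabs (t - z)) ->
  forall x, opdom T x -> hnorm (T x) <= k * hnorm (T x - z *: x).
Proof.
move=> nT k1 hk x hx.
have k0 : 0 < k by apply: lt_trans k1.
have kk : 0 < k ^+ 2 - 1 by rewrite subr_gt0 exprn_egt1.
have kn : k ^+ 2 - 1 != 0 by rewrite gt_eqF.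
pose s := k ^+ 2 / (k ^+ 2 - 1); pose r := k / (k ^+ 2 - 1) * cabs z.
have r0 : 0 <= r by rewrite mulr_ge0 ?cabs_ge0 // divr_ge0 // ltW.
have hgap : r * hnorm x <= hnorm (T x - (s%:C * z) *: x).
  apply: (spectrum_distance nT) hx => t /hk ht.
  have sq : cabs t ^+ 2 <= k ^+ 2 * cabs (t - z) ^+ 2.
    by rewrite -exprMn lerXn2r ?nnegrE ?mulr_ge0 ?cabs_ge0 // ltW.
  rewrite -(@ler_pXn2r _ 2%N) ?nnegrE ?cabs_ge0 // exprMn -subr_ge0 -(pmulr_rge0 _ kk).
  pose b := complex.Re t * complex.Re z + complex.Im t * complex.Im z.
  have e1 : cabs (t - z) ^+ 2 = cabs t ^+ 2 - 2 * b + cabs z ^+ 2.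
    by rewrite !cabs_sqr /b; case: (t) (z) => ? ? [? ?] /=; ring.
  have e2 : cabs (t - s%:C * z) ^+ 2 = cabs t ^+ 2 - 2 * (s * b) + s ^+ 2 * cabs z ^+ 2.
    by rewrite !cabs_sqr /b; case: (t) (z) => ? ? [? ?] /=; ring.
  by rewrite e2 -apollonius // -e1 subr_ge0.
rewrite -(@ler_pXn2r _ 2%N) ?nnegrE ?hnorm_ge0 ?mulr_ge0 ?hnorm_ge0 ?(ltW k0) //.
rewrite exprMn -subr_ge0 (hnorm_sqrB hdot) (apollonius _ _ _ kn) pmulr_rge0 //.
have sq : (r * hnorm x) ^+ 2 <= hnorm (T x - (s%:C * z) *: x) ^+ 2.
  by rewrite lerXn2r // nnegrE ?hnorm_ge0 // mulr_ge0 ?hnorm_ge0.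
move: sq; rewrite -scalerA (hnorm_sqrB hdot) rdotZr !hnormZ cabs_real.
rewrite /r /s !exprMn real_normK ?num_real // !exprMn; lra.
Qed.

(** [T + A - z = (1 + A B) (T - z)] with [B = (T - z)^-1], and [A B] has norm at
    most [q < 1]. Solving [u + A (B u) = y] is finding a fixed point of the
    contraction [G]. *)
Lemma resolvent_perturbation (T A : operator H) (q : R) z :
  linear_operator T -> linear_operator A -> opdom T `<=` opdom A ->
  resolvent_set T z -> 0 <= q -> q < 1 ->
  (forall x, opdom T x -> hnorm (A x) <= q * hnorm (T x - z *: x)) ->
  resolvent_set (op_add T A) z.
Proof.
move=> lT lA TA rz q0 q1 hA.
have [K K0 hK] := resolvent_bound rz.
have [B hB] := resolvent_inverse rz.
have NB x x' : opdom T x -> opdom T x' ->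
    T (x - x') - z *: (x - x') = (T x - z *: x) - (T x' - z *: x').
  move=> hx hx'; rewrite (opfunB lT hx hx') scalerBr !opprB addrACA.
  by rewrite [RHS]addrACA [- T x' + _]addrC.
have lower x : opdom T x -> (1 - q) * hnorm x <= K * hnorm (T x + A x - z *: x).
  move=> hx.
  have h1 : hnorm (T x - z *: x) <= hnorm (T x + A x - z *: x) + hnorm (A x).
    rewrite -(hnormN (A x)); apply: le_trans (hnormD _ _).
    by rewrite [X in hnorm (X - A x)]addrAC addrK.
  have h2 : (1 - q) * hnorm (T x - z *: x) <= hnorm (T x + A x - z *: x).
    by have := hA x hx; lra.
  have q1' : 0 <= 1 - q by rewrite subr_ge0 ltW.
  have h3 := ler_wpM2l q1' (hK x hx); have h4 := ler_wpM2l (ltW K0) h2.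
  lra.
have surj y : exists2 x, opdom T x & T x + A x - z *: x = y.
  pose G u := y - A (B u).
  have ctr u u' : hnorm (G u - G u') <= q * hnorm (u - u').
    have [d1 n1] := hB u; have [d2 n2] := hB u'.
    have := hA _ (opdomB lT d1 d2); rewrite NB // n1 n2.
    rewrite (opfunB lA (TA _ d1) (TA _ d2)).
    have -> // : G u - G u' = A (B u') - A (B u).
      by rewrite /G opprB addrC addrA subrK.
    by rewrite hnormB.
  pose u n := iter n G 0.
  pose C := hnorm (u 0%N - u 1%N) / (1 - q).
  have q1' : 0 < 1 - q by rewrite subr_gt0.
  have far j : hnorm (u 0%N - u j) <= C.
    elim: j => [|j IH].
      by rewrite subrr hnorm0 divr_ge0 ?hnorm_ge0 // ltW.
    apply: (le_trans (hnorm_triangle (u 1%N) _ _)).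
    have h1 := ctr (u 0%N) (u j).
    have h2 := ler_wpM2l q0 IH.
    have h3 : hnorm (u 0%N - u 1%N) = (1 - q) * C.
      by rewrite /C; field; rewrite gt_eqF.
    rewrite h3 -[u 1%N]/(G (u 0%N)) -[u j.+1]/(G (u j)); lra.
  have cau i j : (i <= j)%N -> hnorm (u i - u j) <= C * q ^+ i.
    elim: i j => [|i IH] [|j] //; first by rewrite expr0 mulr1 subrr -(subrr (u 0%N)).
      by rewrite expr0 mulr1.
    rewrite ltnS => /IH h; apply: (le_trans (ctr _ _)).
    by rewrite exprS mulrCA ler_wpM2l.
  have c0 : C * q ^+ n @[n --> \oo] --> (0 : R).
    by apply: cvg_geometric; rewrite ger0_norm.
  have [l hl] := cauchy_rate cau c0.
  have Gl : G l = l.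
    apply/subr0_eq/hnorm_eq0/eqP; rewrite eq_le hnorm_ge0 andbT.
    apply: (le0_rate (c := 2) c0) => n.
    apply: (le_trans (hnorm_triangle (u n.+1) _ _)).
    have h1 := ctr l (u n); have h2 := hl n.+1; have h3 := hl n.
    have h4 := ler_wpM2l q0 h3.
    have C0 : 0 <= C * q ^+ n := le_trans (hnorm_ge0 _) h3.
    have h5 := mulr_ge0 (ltW q1') C0.
    rewrite (hnormB l) in h1; rewrite exprS mulrCA in h2.
    rewrite -[u n.+1]/(G (u n)) in h2 *; lra.
  have [d1 n1] := hB l; exists (B l) => //.
  by rewrite addrAC n1 -{1}Gl /G subrK.
have inj x x' : opdom T x -> opdom T x' ->
    T x + A x - z *: x = T x' + A x' - z *: x' -> x = x'.
  move=> hx hx' e; apply/subr0_eq/hnorm_eq0/eqP; rewrite eq_le hnorm_ge0 andbT.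
  have := lower _ (opdomB lT hx hx').
  rewrite addrAC NB // (opfunB lA (TA _ hx) (TA _ hx')) addrACA -opprD.
  rewrite [T x - _ + _]addrAC e [T x' + _ - _]addrAC subrr hnorm0 mulr0.
  by rewrite pmulr_rle0 // subr_gt0.
have ex y : exists x, opdom T x /\ T x + A x - z *: x = y.
  by have [x] := surj y; exists x.
have [B' hB'] := choice ex.
split.
  split=> [//|x x' /set_mem hx /set_mem hx'|y _]; first exact: inj.
  by have [x hx <-] := surj y; exists x.
exists B' => [x hx|].
  by have [h1 h2] := hB' (op_add T A x - z *: x); apply: inj.
exists (K / (1 - q)) => y; have [h1 h2] := hB' y.
by rewrite mulrAC ler_pdivlMr ?subr_gt0 // mulrC -[y in leRHS]h2 lower.
Qed.
End Perturbation.

(** * Geometry of the strip *)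

Section Strip.
Variable R : realType.
Implicit Types (z t : R[i]).

Lemma Re_le_cabs z : `|complex.Re z| <= cabs z.
Proof.
rewrite -(@ler_pXn2r _ 2%N) ?nnegrE ?cabs_ge0 // cabs_sqr.
by rewrite real_normK ?num_real // lerDl sqr_ge0.
Qed.

Lemma cabs_le_Im (a v g : R) : `|v| <= g -> cabs (a +i* v) <= cabs (a +i* g).
Proof.
move=> vg; rewrite -(@ler_pXn2r _ 2%N) ?nnegrE ?cabs_ge0 // !cabs_sqr /= lerD2l.
rewrite -(real_normK (num_real v)) lerXn2r ?nnegrE ?normr_ge0 //.
exact: le_trans vg.
Qed.

(** The vertical line through [a] separates [t] from [z]. On that line [|t|] is
    at most [M] and the horizontal distance to [z] at least [d]; moving away
    from the line by [l] adds at most [l] to the former and exactly [l] to the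
    latter, and [d (M + l) <= M (d + l)] since [d <= M]. *)
Lemma edge_ratio (a g d M : R) z t : 0 <= d -> d <= M ->
  cabs (a +i* g) <= M -> `|complex.Im t| <= g ->
  `|complex.Re t - complex.Re z| = `|complex.Re t - a| + `|a - complex.Re z| ->
  d <= `|a - complex.Re z| ->
  d * cabs t <= M * cabs (t - z).
Proof.
move=> d0 dM aM tg edge dz.
have ht : cabs t <= M + `|complex.Re t - a|.
  have tE : t = (a +i* complex.Im t) + (complex.Re t - a)%:C.
    case: t {tg edge} => u v; apply/eqP.
    by rewrite eq_complex /= addr0 eqxx andbT addrC subrK.
  rewrite {1}tE (le_trans (cabsD _ _)) // cabs_real.
  by rewrite lerD2r (le_trans _ aM) // cabs_le_Im.
have htz : d + `|complex.Re t - a| <= cabs (t - z).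
  apply: le_trans (Re_le_cabs _); case: t z edge {tg ht} dz => ? ? [? ?] /= -> dz.
  by rewrite addrC lerD2l.
have M0 : 0 <= M by apply: le_trans dM.
apply: (le_trans (ler_wpM2l d0 ht)); apply: le_trans (ler_wpM2l M0 htz).
by rewrite !mulrDr (mulrC d) lerD2l ler_wpM2r.
Qed.
End Strip.

Theorem theorem6p1 (R : realType) (H : completeNormedModType R[i])
    (dot : {dot H for @Num.conj R[i]}) (hdot : induces_norm dot)
    (T A : operator H) (p c : R)
    (hT : normal_operator dot T)
    (hp0 : 0 <= p) (hp1 : p <= 1) (hc : 0 <= c)
    (hA : linear_operator A)
    (hTA : opdom T `<=` opdom A)
    (hbound : forall x : H, opdom T x ->
       hnorm (A x) <= c * hnorm x `^ (1 - p) * hnorm (T x) `^ p)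
    (alpha beta gamma : R) (hab : alpha < beta)
    (hstrip : [set z : R[i] | alpha < complex.Re z < beta]
                `<=` resolvent_set T)
    (hg : 0 <= gamma)
    (hspec : forall t : R[i], spectrum T t -> `|complex.Im t| <= gamma) :
  let m := Num.max (cabs (alpha +i* gamma) `^ p)
                   (cabs (beta +i* gamma) `^ p) in
  2 * c * m < beta - alpha ->
  [set z : R[i] | alpha + c * m < complex.Re z < beta - c * m]
    `<=` resolvent_set (op_add T A).
Proof.
move=> m _ z /= /andP[az zb].
have m0 : 0 <= m by rewrite le_max powR_ge0.
have cm0 : 0 <= c * m by rewrite mulr_ge0.
pose d0 := Num.min (complex.Re z - alpha) (beta - complex.Re z).
have cmd0 : c * m < d0 by rewrite lt_min; apply/andP; split; lra.
(* Strictly less than the distance [d0] to the edges, so that [M / d > 1] and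
   the disc of Apollonius is bounded. *)
pose d := (c * m + d0) / 2.
have cmd : c * m < d by rewrite /d; lra.
have d_gt0 : 0 < d by apply: le_lt_trans cmd.
have dd0 : d < d0 by rewrite /d; lra.
have [da db] : d < complex.Re z - alpha /\ d < beta - complex.Re z.
  by apply/andP; rewrite -lt_min.
pose M := Num.max (cabs (alpha +i* gamma)) (cabs (beta +i* gamma)).
have aM : cabs (alpha +i* gamma) <= M by rewrite le_max lexx.
have bM : cabs (beta +i* gamma) <= M by rewrite le_max lexx orbT.
(* [2 d < beta - alpha <= 2 M]. *)
have dM : d < M.
  have := le_trans (Re_le_cabs _) aM; have := le_trans (Re_le_cabs _) bM => /=.
  have := ler_norm beta; have := ler_norm (- alpha); rewrite normrN; lra.
have Mm : M `^ p <= m.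
  rewrite /M; have [_|_] := leP (cabs (alpha +i* gamma)) (cabs (beta +i* gamma)).
    by rewrite le_max lexx orbT.
  by rewrite le_max lexx.
have rz : resolvent_set T z by apply: hstrip => /=; apply/andP; split; lra.
have out t : spectrum T t -> complex.Re t <= alpha \/ beta <= complex.Re t.
  move=> st; have [|ta] := leP (complex.Re t) alpha; first by left.
  have [|tb] := leP beta (complex.Re t); first by right.
  by case: st; apply: hstrip; rewrite /= ta tb.
have dist t : spectrum T t -> d <= cabs (t - z).
  move=> /out ht; apply: le_trans (Re_le_cabs _).
  rewrite ler_normr; case: t ht => u v; case: (z) da db => x y /= da db ht.
  by apply/orP; case: ht => h; [right|left]; lra.
have ratio t : spectrum T t -> cabs t <= M / d * cabs (t - z).
  move=> st; rewrite mulrAC ler_pdivlMr // mulrC.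
  case: (out t st) => h.
    apply: (edge_ratio (ltW d_gt0) (ltW dM) aM (hspec _ st)).
      by rewrite !ler0_norm; lra.
    by rewrite ler0_norm; lra.
  apply: (edge_ratio (ltW d_gt0) (ltW dM) bM (hspec _ st)).
    by rewrite !ger0_norm; lra.
  by rewrite ger0_norm; lra.
have Md : 1 < M / d by rewrite ltr_pdivlMr // mul1r.
have lT : linear_operator T by case: hT.
apply: (@resolvent_perturbation _ _ T A (c * m / d)) => //.
- by rewrite divr_ge0 // ltW.
- by rewrite ltr_pdivrMr // mul1r.
move=> x hx; set n := hnorm (T x - z *: x).
have n0 : 0 <= n := hnorm_ge0 _.
have hx1 : hnorm x <= n / d.
  by rewrite ler_pdivlMr // mulrC; exact: (spectrum_distance hdot hT dist hx).
have hx2 : hnorm (T x) <= M * (n / d).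
  by rewrite mulrA mulrAC; exact: (spectrum_ratio hdot hT Md ratio hx).
have nd0 : 0 <= n / d by rewrite divr_ge0 // ltW.
have M0 : 0 <= M by rewrite ltW // (lt_trans d_gt0).
have e1 : hnorm x `^ (1 - p) <= (n / d) `^ (1 - p).
  by rewrite ge0_ler_powR ?nnegrE ?hnorm_ge0 // subr_ge0.
have e2 : hnorm (T x) `^ p <= M `^ p * (n / d) `^ p.
  have Mnd0 : 0 <= M * (n / d) by apply: mulr_ge0.
  by rewrite -powRM // ge0_ler_powR ?nnegrE ?hnorm_ge0.
have e3 : (n / d) `^ (1 - p) * (n / d) `^ p = n / d.
  by rewrite -powRD ?subrK ?powRr1 // oner_eq0.
apply: (le_trans (hbound x hx)).
have -> : c * m / d * n = c * (m * (n / d)) by ring.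
rewrite -mulrA ler_wpM2l // (le_trans (ler_pM _ _ e1 e2)) ?powR_ge0 //.
by rewrite mulrCA e3 ler_wpM2r.
Qed.
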